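(* Let $X$ be a sum of cycles with $n\ge 2$ vertices, and let $\mathrm{fact}(X)$ be the number of irreducible factorizations of $X$. Then $$\mathrm{fact}(X)\leq p^{\times}(n)\leq n\,e^{c_0\sqrt{n}},\qquad\text{where } c_0=\pi\sqrt{2/3}.$$ In particular, the number of irreducible factorizations of a sum of cycles with $n$ vertices is at most $e^{O(\sqrt n)}$.
   Context: A sum of cycles is a finite digraph that is a disjoint union of directed cycles, considered up to isomorphism; $|A|$ is the number of vertices of $A$. The product $AB$ is the direct product of digraphs, i.e. the distributive product (over disjoint union) with $C_aC_b=\gcd(a,b)\,C_{\operatorname{lcm}(a,b)}$, where $C_\ell$ is the directed cycle of length $\ell$ and $nC_\ell$ denotes $n$ disjoint copies of it. A sum of cycles $X$ is irreducible if, for all sums of cycles $A,B$, $X=AB$ implies $A=C_1$ or $B=C_1$. The number of irreducible factorizations of $X$ is the number of ways of expressing $X$ as a product of irreducible sums of cycles, each distinct from $C_1$, the order of the factors being irrelevant. For $n\ge 2$, $P^{\times}(n)$ is the set of finite sequences of sums of cycles $(A_1,\dots,A_k)$ such that $2\leq |A_1|\leq \cdots \leq |A_k|$ and $|A_1A_2\cdots A_k|=n$, and $p^{\times}(n)=|P^{\times}(n)|$. *)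

(* Defs.v *)
From HB Require Import structures.
From mathcomp Require Import all_boot all_order all_algebra finmap multiset.
From mathcomp Require Import all_classical all_reals all_analysis.
Set Implicit Arguments.
Unset Strict Implicit.
Unset Printing Implicit Defensive.
Import Order.TTheory GRing.Theory Num.Theory.
Import numFieldNormedType.Exports.

Local Open Scope mset_scope.
Local Open Scope classical_set_scope.
Local Open Scope nat_scope.

(** A sum of cycles up to isomorphism is encoded by the multiset of the lengths
    of its cycles. The section on digraphs below proves that the encoding is
    faithful: [digraph_of] realizes such a multiset as a disjoint union of
    directed cycles, two multisets give isomorphic digraphs only if they are
    equal ([digraph_of_inj]), and [soc_mul] is the direct product
    ([digraph_of_mul]). *)

Record soc : Type := Soc { lengths : {mset nat}; _ : 0 \notin lengths }.

HB.instance Definition _ := [isSub for lengths].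
HB.instance Definition _ := [Choice of soc by <:].

Definition nvert (A : soc) : nat := \sum_(l <- lengths A) l.

Definition lengths_mul (s t : seq nat) : seq nat :=
  flatten [seq nseq (gcdn a b) (lcmn a b) | a <- s, b <- t].

Lemma lengths_mul_pos (s t : seq nat) :
  0 \notin s -> 0 \notin t -> 0 \notin lengths_mul s t.
Proof.
move=> s0 t0; apply/negP => /flattenP[_ /allpairsP[[a b] /= [sa tb ->]]].
rewrite mem_nseq => /andP[_ /eqP/esym/eqP].
have a0 : 0 < a by rewrite lt0n; apply: contraNneq s0 => <-.
have b0 : 0 < b by rewrite lt0n; apply: contraNneq t0 => <-.
by rewrite eqn0Ngt lcmn_gt0 a0 b0.
Qed.

Fact soc_mul_subproof (A B : soc) :
  0 \notin seq_mset (lengths_mul (lengths A) (lengths B)).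
Proof.
by rewrite (perm_mem (perm_eq_seq_mset _)) lengths_mul_pos ?(valP A) ?(valP B).
Qed.

Definition soc_mul (A B : soc) : soc := Soc (soc_mul_subproof A B).

Fact soc_one_subproof : 0 \notin [mset 1]%mset.
Proof. by rewrite in_mset1. Qed.

(** The single cycle of length 1. *)
Definition soc_one : soc := Soc soc_one_subproof.

Definition soc_prod (s : seq soc) : soc := \big[soc_mul/soc_one]_(A <- s) A.

Definition soc_irreducible (X : soc) : Prop :=
  forall A B : soc, X = soc_mul A B -> A = soc_one \/ B = soc_one.

(** Factorizations are multisets of factors since their order is irrelevant.
    [soc_one] satisfies [soc_irreducible] and is excluded separately. *)
Definition irr_factorizations (X : soc) : set {mset soc} :=
  [set F | (forall A, A \in F -> soc_irreducible A /\ A <> soc_one) /\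
           soc_prod F = X].

(** [fset_set] sends an infinite set to [fset0], so these cardinalities are
    meaningful only for finite sets. *)
Definition fact (X : soc) : nat := #|` fset_set (irr_factorizations X)|.

Definition Ptimes (n : nat) : set (seq soc) :=
  [set s | all (fun A => 2 <= nvert A) s /\ sorted leq (map nvert s) /\
           nvert (soc_prod s) = n].

Definition ptimes (n : nat) : nat := #|` fset_set (Ptimes n)|.

(** * Correspondence with digraphs *)

Record digraph : Type := Digraph { vertex : finType; edge : rel vertex }.

Definition isomorphic (D D' : digraph) : Prop :=
  exists2 f : vertex D -> vertex D', bijective f &
    forall x y, edge (f x) (f y) = edge x y.

Definition directed_cycle (l : nat) : digraph :=
  Digraph (fun i j : 'I_l => nat_of_ord j == i.+1 %% l).

Definition empty_digraph : digraph := Digraph (fun _ _ : void => false).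

Definition disjoint_union (D D' : digraph) : digraph :=
  Digraph (fun x y : vertex D + vertex D' =>
    match x, y with
    | inl x, inl y => edge x y
    | inr x, inr y => edge x y
    | _, _ => false
    end).

Definition direct_product (D D' : digraph) : digraph :=
  Digraph (fun x y : vertex D * vertex D' => edge x.1 y.1 && edge x.2 y.2).

Fixpoint union_of_cycles (s : seq nat) : digraph :=
  if s is l :: s then disjoint_union (directed_cycle l) (union_of_cycles s)
  else empty_digraph.

Definition digraph_of (A : soc) : digraph := union_of_cycles (lengths A).

Lemma isomorphic_refl (D : digraph) : isomorphic D D.
Proof. by exists id => //; exists id. Qed.

Lemma isomorphic_sym (D D' : digraph) : isomorphic D D' -> isomorphic D' D.
Proof.
case=> f [g fK gK] fE; exists g; first by exists f.
by move=> x y; rewrite -fE !gK.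
Qed.

Lemma isomorphic_trans (D2 D1 D3 : digraph) :
  isomorphic D1 D2 -> isomorphic D2 D3 -> isomorphic D1 D3.
Proof.
case=> f fb fE [g gb gE]; exists (g \o f); first exact: bij_comp.
by move=> x y /=; rewrite gE fE.
Qed.

Lemma disjoint_union_iso (D1 D1' D2 D2' : digraph) :
  isomorphic D1 D1' -> isomorphic D2 D2' ->
  isomorphic (disjoint_union D1 D2) (disjoint_union D1' D2').
Proof.
case=> f [f' fK f'K] fE [g [g' gK g'K] gE].
exists (fun x : vertex (disjoint_union D1 D2) =>
  match x with inl x => inl (f x) | inr x => inr (g x) end
  : vertex (disjoint_union D1' D2')).
  exists (fun x : vertex (disjoint_union D1' D2') =>
    match x with inl x => inl (f' x) | inr x => inr (g' x) end).
    by case=> x; rewrite ?fK ?gK.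
  by case=> x; rewrite ?f'K ?g'K.
by case=> x [] y /=; rewrite ?fE ?gE.
Qed.

Lemma disjoint_unionC (D1 D2 : digraph) :
  isomorphic (disjoint_union D1 D2) (disjoint_union D2 D1).
Proof.
exists (fun x : vertex (disjoint_union D1 D2) =>
  match x with inl x => inr x | inr x => inl x end
  : vertex (disjoint_union D2 D1)).
  by exists (fun x : vertex (disjoint_union D2 D1) =>
    match x with inl x => inr x | inr x => inl x end); case.
by case=> x [].
Qed.

Lemma disjoint_unionA (D1 D2 D3 : digraph) :
  isomorphic (disjoint_union D1 (disjoint_union D2 D3))
             (disjoint_union (disjoint_union D1 D2) D3).
Proof.
exists (fun x : vertex (disjoint_union D1 (disjoint_union D2 D3)) =>
  match x with
  | inl x => inl (inl x) | inr (inl x) => inl (inr x) | inr (inr x) => inr x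
  end : vertex (disjoint_union (disjoint_union D1 D2) D3)).
  by exists (fun x : vertex (disjoint_union (disjoint_union D1 D2) D3) =>
    match x with
    | inl (inl x) => inl x | inl (inr x) => inr (inl x) | inr x => inr (inr x)
    end); do 2?case.
by case=> [x|[x|x]] [y|[y|y]].
Qed.

Lemma disjoint_union0 (D : digraph) :
  isomorphic D (disjoint_union empty_digraph D).
Proof.
exists (inr : vertex D -> vertex (disjoint_union empty_digraph D)) => //.
exists (fun x : vertex (disjoint_union empty_digraph D) =>
  match x with inl x => match x with end | inr x => x end) => //.
by case=> // -[].
Qed.

Lemma direct_product_unionl (D1 D2 D : digraph) :
  isomorphic (disjoint_union (direct_product D1 D) (direct_product D2 D))
             (direct_product (disjoint_union D1 D2) D).
Proof.
exists (fun x : vertex (disjoint_union (direct_product D1 D)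
                                       (direct_product D2 D)) =>
  match x with inl x => (inl x.1, x.2) | inr x => (inr x.1, x.2) end
  : vertex (direct_product (disjoint_union D1 D2) D)).
  exists (fun x : vertex (direct_product (disjoint_union D1 D2) D) =>
    match x.1 with inl y => inl (y, x.2) | inr y => inr (y, x.2) end).
    by do 2?case.
  by do 2?case.
by case=> x [] y.
Qed.

Lemma direct_productC (D1 D2 : digraph) :
  isomorphic (direct_product D1 D2) (direct_product D2 D1).
Proof.
exists (fun x : vertex (direct_product D1 D2) =>
  (x.2, x.1) : vertex (direct_product D2 D1)).
  by exists (fun x : vertex (direct_product D2 D1) => (x.2, x.1)); case.
by move=> x y /=; rewrite andbC.
Qed.

Lemma direct_product_iso (D1 D1' D2 D2' : digraph) :
  isomorphic D1 D1' -> isomorphic D2 D2' ->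
  isomorphic (direct_product D1 D2) (direct_product D1' D2').
Proof.
case=> f [f' fK f'K] fE [g [g' gK g'K] gE].
exists (fun x : vertex (direct_product D1 D2) =>
  (f x.1, g x.2) : vertex (direct_product D1' D2')).
  exists (fun x : vertex (direct_product D1' D2') => (f' x.1, g' x.2)).
    by case=> x y /=; rewrite fK gK.
  by case=> x y /=; rewrite f'K g'K.
by move=> x y /=; rewrite fE gE.
Qed.

Lemma direct_productA (D1 D2 D3 : digraph) :
  isomorphic (direct_product D1 (direct_product D2 D3))
             (direct_product (direct_product D1 D2) D3).
Proof.
exists (fun x : vertex (direct_product D1 (direct_product D2 D3)) =>
  ((x.1, x.2.1), x.2.2) : vertex (direct_product (direct_product D1 D2) D3)).
  exists (fun x : vertex (direct_product (direct_product D1 D2) D3) =>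
    (x.1.1, (x.1.2, x.2))); first by case=> ? [].
  by do 2?case.
by move=> x y /=; rewrite andbA.
Qed.

Lemma direct_product_unionr (D1 D2 D : digraph) :
  isomorphic (disjoint_union (direct_product D D1) (direct_product D D2))
             (direct_product D (disjoint_union D1 D2)).
Proof.
apply: isomorphic_trans (direct_productC _ _).
apply: isomorphic_trans (direct_product_unionl _ _ _).
by apply: disjoint_union_iso; apply: direct_productC.
Qed.

Lemma union_of_cycles_cat (s t : seq nat) :
  isomorphic (disjoint_union (union_of_cycles s) (union_of_cycles t))
             (union_of_cycles (s ++ t)).
Proof.
elim: s => [|l s IHs] /=; first exact/isomorphic_sym/disjoint_union0.
apply: isomorphic_trans (isomorphic_sym (disjoint_unionA _ _ _)) _.
exact: disjoint_union_iso (isomorphic_refl _) IHs.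
Qed.

Lemma union_of_cycles_perm (s t : seq nat) :
  perm_eq s t -> isomorphic (union_of_cycles s) (union_of_cycles t).
Proof.
elim: s t => [|l s IHs] t.
  by rewrite perm_sym => /perm_nilP->; apply: isomorphic_refl.
move=> st; have lt : l \in t by rewrite -(perm_mem st) mem_head.
case/splitPr: lt st => t1 t2; rewrite perm_sym perm_catC /= perm_cons => st.
have {}st: perm_eq s (t1 ++ t2) by rewrite perm_sym perm_catC.
apply: isomorphic_trans (union_of_cycles_cat _ _) => /=.
apply: isomorphic_trans (isomorphic_sym (disjoint_unionA _ _ _)).
apply: isomorphic_trans (disjoint_union_iso (isomorphic_refl _)
  (isomorphic_trans (IHs _ st) (isomorphic_sym (union_of_cycles_cat _ _)))) _.
apply: isomorphic_trans (disjoint_unionA _ _ _) _.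
apply: isomorphic_trans (disjoint_union_iso (disjoint_unionC _ _)
  (isomorphic_refl _)) _.
exact: isomorphic_refl.
Qed.

Definition copies (g : nat) (D : digraph) : digraph :=
  Digraph (fun x y : 'I_g * vertex D => (x.1 == y.1) && edge x.2 y.2).

Lemma union_of_cycles_nseq (g l : nat) :
  isomorphic (copies g (directed_cycle l)) (union_of_cycles (nseq g l)).
Proof.
elim: g => [|g IHg] /=.
  exists (fun x : vertex (copies 0 (directed_cycle l)) =>
    match notF (ltn_ord x.1) with end : vertex empty_digraph); last first.
    by case=> -[].
  by exists (fun x : vertex empty_digraph => match x with end); do 2?case.
apply: isomorphic_trans (disjoint_union_iso (isomorphic_refl _) IHg).
apply: isomorphic_sym.
pose C := directed_cycle l.
exists (fun x : vertex (disjoint_union C (copies g C)) =>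
  match x with inl x => (ord0, x) | inr x => (lift ord0 x.1, x.2) end
  : vertex (copies g.+1 C)); last first.
  by case=> x [] y //=; rewrite (inj_eq (@lift_inj _ _)).
exists (fun x : vertex (copies g.+1 C) =>
  if unlift ord0 x.1 is Some r then inr (r, x.2) else inl x.2).
  by case=> [x|[r x]] /=; rewrite ?unlift_none ?liftK.
by case=> r x /=; case: unliftP => [j|] ->.
Qed.

Lemma modSn_mod (m d : nat) : (m %% d).+1 = m.+1 %[mod d].
Proof. by rewrite -addn1 modnDml addn1. Qed.

Lemma directed_cycle_mul (a b : nat) : 0 < a -> 0 < b ->
  isomorphic (copies (gcdn a b) (directed_cycle (lcmn a b)))
             (direct_product (directed_cycle a) (directed_cycle b)).
Proof.
move=> a0 b0.
pose f (x : vertex (copies (gcdn a b) (directed_cycle (lcmn a b)))) :=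
  (Ordinal (ltn_pmod x.2 a0), Ordinal (ltn_pmod (x.2 + x.1) b0))
  : vertex (direct_product (directed_cycle a) (directed_cycle b)).
have fI : injective f.
  case=> [r k] [r' k'] [] /= ka kb.
  have rr' : r = r'.
    apply: val_inj => /=; rewrite -(modn_small (ltn_ord r)).
    rewrite -[in RHS](modn_small (ltn_ord r')); apply/eqP.
    have /eqP kg : k = k' %[mod gcdn a b].
      by rewrite -(modn_dvdm _ (dvdn_gcdl a b)) ka modn_dvdm // dvdn_gcdl.
    have /eqP : k + r = k' + r' %[mod gcdn a b].
      by rewrite -(modn_dvdm _ (dvdn_gcdr a b)) kb modn_dvdm // dvdn_gcdr.
    by rewrite -modnDml (eqP kg) modnDml eqn_modDl.
  subst r'; congr pair; apply: val_inj => /=.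
  have {}kb : k = k' %[mod b] by apply/eqP; rewrite -(eqn_modDr r); apply/eqP.
  wlog kk' : k k' ka kb / k' <= k.
    by move=> W; case/orP: (leq_total k' k) => /W->.
  rewrite -(modn_small (ltn_ord k)) -[in RHS](modn_small (ltn_ord k')).
  apply/eqP; rewrite eqn_mod_dvd // dvdn_lcm -!eqn_mod_dvd //.
  by rewrite ka kb !eqxx.
have fB : bijective f.
  apply: inj_card_bij fI _.
  change (#|{: 'I_a * 'I_b}| <= #|{: 'I_(gcdn a b) * 'I_(lcmn a b)}|).
  by rewrite !card_prod !card_ord [leqRHS]mulnC muln_lcm_gcd.
exists f => // -[r k] [r' k'] /=.
have l0 : 0 < lcmn a b by rewrite lcmn_gt0 a0.
pose k1 : vertex (directed_cycle (lcmn a b)) := Ordinal (ltn_pmod k.+1 l0).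
have fE : f (r, k1) = (Ordinal (ltn_pmod k.+1 a0),
                       Ordinal (ltn_pmod (k + r).+1 b0)).
  congr pair; apply: val_inj => /=; first by rewrite modn_dvdm ?dvdn_lcml.
  by rewrite -modnDml modn_dvdm ?dvdn_lcmr // modnDml addSn.
have -> : (r == r') && (nat_of_ord k' == k.+1 %% lcmn a b) =
          ((r', k') == (r, k1)) by rewrite xpair_eqE (eq_sym r).
rewrite -(inj_eq fI) fE xpair_eqE -!val_eqE /=.
by rewrite !modSn_mod.
Qed.

Lemma union_of_cycles_mul (s t : seq nat) : 0 \notin s -> 0 \notin t ->
  isomorphic (union_of_cycles (lengths_mul s t))
             (direct_product (union_of_cycles s) (union_of_cycles t)).
Proof.
elim: s => [|a s IHs].
  move=> _ _; exists (fun x : void => match x with end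
    : vertex (direct_product empty_digraph (union_of_cycles t))); last by case.
  by exists (fun x : vertex (direct_product empty_digraph (union_of_cycles t))
    => match x.1 with end); do 2?case.
rewrite inE negb_or eq_sym -lt0n => /andP[a0 s0] t0.
rewrite /lengths_mul allpairs_cons flatten_cat.
apply: isomorphic_trans (isomorphic_sym (union_of_cycles_cat _ _)) _.
apply: isomorphic_trans (direct_product_unionl _ _ _).
apply: disjoint_union_iso (IHs s0 t0).
elim: t t0 {IHs} => [|b t IHt].
  move=> _; exists (fun x : void => match x with end
    : vertex (direct_product (directed_cycle a) empty_digraph)); last by case.
  by exists (fun x : vertex (direct_product (directed_cycle a) empty_digraph)
    => match x.2 with end) => -[] // ? [].
rewrite inE negb_or eq_sym -lt0n => /andP[b0 t0] /=.
apply: isomorphic_trans (isomorphic_sym (union_of_cycles_cat _ _)) _.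
apply: isomorphic_trans (direct_product_unionr _ _ _).
apply: disjoint_union_iso (IHt t0).
exact: isomorphic_trans (isomorphic_sym (union_of_cycles_nseq _ _))
  (directed_cycle_mul a0 b0).
Qed.

Lemma digraph_of_mul (A B : soc) :
  isomorphic (digraph_of (soc_mul A B))
             (direct_product (digraph_of A) (digraph_of B)).
Proof.
apply: isomorphic_trans (union_of_cycles_mul (valP A) (valP B)).
exact/union_of_cycles_perm/perm_eq_seq_mset.
Qed.

Lemma card_digraph_of (A : soc) : #|vertex (digraph_of A)| = nvert A.
Proof.
rewrite /nvert /digraph_of; elim: (enum_mset _) => [|l s IHs] /=.
  by rewrite big_nil card_void.
by rewrite big_cons card_sum card_ord IHs.
Qed.

(** Every disjoint union of directed cycles is obtained from some [soc]. *)
Lemma digraph_of_surj (s : seq nat) : 0 \notin s ->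
  exists A : soc, isomorphic (union_of_cycles s) (digraph_of A).
Proof.
rewrite -(perm_mem (perm_eq_seq_mset s)) => s0; exists (Soc s0).
by apply/isomorphic_sym/union_of_cycles_perm/perm_eq_seq_mset.
Qed.

Fixpoint walk (D : digraph) (k : nat) (x y : vertex D) : bool :=
  if k is k'.+1 then [exists z, edge x z && walk k' z y] else x == y.

Definition closed_walks (D : digraph) (k : nat) : nat :=
  #|[pred x : vertex D | walk k x x]|.

Lemma closed_walks_iso (D D' : digraph) (k : nat) :
  isomorphic D D' -> closed_walks D k = closed_walks D' k.
Proof.
case=> f [g fK gK] fE.
have fI := can_inj fK.
have wE x y : walk k (f x) (f y) = walk k x y.
  elim: k x y => [|k IHk] x y /=; first by rewrite (inj_eq fI).
  apply/existsP/existsP => -[z xzy].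
    by exists (g z); rewrite -fE -IHk gK.
  by exists (f z); rewrite fE IHk.
rewrite /closed_walks -(fintype.card_image fI); apply: eq_card => y.
apply/fintype.imageP/idP => [[x + ->]|yy]; first by rewrite !inE wE.
by exists (g y); rewrite ?gK // inE -wE gK.
Qed.

Lemma closed_walks_union (D D' : digraph) (k : nat) :
  closed_walks (disjoint_union D D') k = closed_walks D k + closed_walks D' k.
Proof.
have wl x y : @walk (disjoint_union D D') k (inl x) (inl y) = walk k x y.
  elim: k x y => [|k IHk] x y //=.
  apply/existsP/existsP => -[].
    by case=> z //=; rewrite IHk; exists z.
  by move=> z zE; exists (inl z); rewrite /= IHk.
have wr x y : @walk (disjoint_union D D') k (inr x) (inr y) = walk k x y.
  elim: k {wl} x y => [|k IHk] x y //=.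
  apply/existsP/existsP => -[].
    by case=> z //=; rewrite IHk; exists z.
  by move=> z zE; exists (inr z); rewrite /= IHk.
rewrite /closed_walks -!sum1_card big_sumType /=.
by congr (_ + _); apply: eq_bigl => x; rewrite !inE ?wl ?wr.
Qed.

Lemma closed_walks_cycle (l k : nat) :
  closed_walks (directed_cycle l) k = if l %| k then l else 0.
Proof.
have wE (i j : vertex (directed_cycle l)) :
    walk k i j = (nat_of_ord j == (i + k) %% l).
  elim: k i => [|k IHk] i /=.
    by rewrite addn0 modn_small ?ltn_ord // -val_eqE eq_sym.
  have l0 : 0 < l by apply: leq_ltn_trans (ltn_ord i).
  apply/existsP/eqP => [[z /andP[/eqP zE]]|jE].
    by rewrite IHk zE => /eqP->; rewrite modnDml addSnnS.
  exists (Ordinal (ltn_pmod i.+1 l0)); rewrite /= eqxx IHk jE /=.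
  by rewrite modnDml addSnnS.
rewrite /closed_walks (eq_card (B := pred_of_simpl [pred x : 'I_l | l %| k])).
  by case: ifP => _; rewrite ?card0 ?card_ord // -[RHS]card_ord; apply: eq_card.
move=> i; rewrite !inE wE -[in X in X == _](modn_small (ltn_ord i)).
by rewrite eq_sym -[X in _ == X %[mod _]]addn0 eqn_modDl mod0n.
Qed.

Lemma closed_walks_cycles (s : seq nat) (k : nat) :
  closed_walks (union_of_cycles s) k = \sum_(l <- s | l %| k) l.
Proof.
elim: s => [|l s IHs] /=; first by rewrite big_nil; apply: eq_card0 => -[].
by rewrite closed_walks_union IHs closed_walks_cycle big_cons; case: ifP.
Qed.

Lemma sum_divisors_count (s : seq nat) (n : nat) :
  \sum_(l <- s | l %| n.+1) l =
  \sum_(m < n.+2 | m %| n.+1) m * count_mem (m : nat) s.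
Proof.
elim: s => [|l s IHs]; first by rewrite big_nil big1 // => m _; rewrite muln0.
rewrite /= big_cons {}IHs.
under [RHS]eq_bigr => m _ do rewrite mulnDr.
rewrite big_split /=; case: ifP => ln; last first.
  rewrite [X in X + _]big1 // => m mn.
  by case: eqP => [lm|_]; rewrite ?muln0 // -lm ln in mn *.
have ln2 : l < n.+2 by rewrite ltnS dvdn_leq.
congr (_ + _); rewrite (bigD1 (Ordinal ln2)) //= eqxx muln1.
rewrite big1 ?addn0 // => m /andP[_].
by rewrite -val_eqE /= eq_sym => /negPf->; rewrite muln0.
Qed.

Lemma digraph_of_inj (A B : soc) :
  isomorphic (digraph_of A) (digraph_of B) -> A = B.
Proof.
move=> AB; apply: val_inj; apply/msetP => k /=.
elim/ltn_ind: k => -[|k] IHk.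
  by rewrite !(mset_eq0P _) ?(valP A) ?(valP B).
have sumE (C : soc) : closed_walks (digraph_of C) k.+1 =
    k.+1 * lengths C k.+1 + \sum_(m < k.+1 | m %| k.+1) m * lengths C m.
  rewrite closed_walks_cycles addnC sum_divisors_count.
  under eq_bigr => m _ do rewrite count_mem_mset.
  by rewrite big_mkcond big_ord_recr /= dvdnn -big_mkcond.
have := closed_walks_iso k.+1 AB; rewrite !sumE.
under eq_bigr => m _ do rewrite IHk //.
by move/addIn/eqP; rewrite eqn_mul2l => /eqP.
Qed.

Lemma soc_mulC : commutative soc_mul.
Proof.
move=> A B; apply: digraph_of_inj.
apply: isomorphic_trans (digraph_of_mul _ _) _.
apply: isomorphic_trans (direct_productC _ _) _.
exact/isomorphic_sym/digraph_of_mul.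
Qed.

Lemma soc_mulA : associative soc_mul.
Proof.
move=> A B C; apply: digraph_of_inj.
apply: isomorphic_trans (digraph_of_mul _ _) _.
apply: isomorphic_trans
  (direct_product_iso (isomorphic_refl _) (digraph_of_mul _ _)) _.
apply: isomorphic_trans (direct_productA _ _ _) _.
apply: isomorphic_sym.
apply: isomorphic_trans (digraph_of_mul _ _) _.
exact: direct_product_iso (digraph_of_mul _ _) (isomorphic_refl _).
Qed.

Lemma soc_mul1 : left_id soc_one soc_mul.
Proof.
move=> A; apply: val_inj => /=; rewrite -[RHS]seq_mset_id; congr seq_mset.
rewrite /lengths_mul enum_msetn /= cats0.
by elim: (enum_mset _) => //= l s ->; rewrite gcd1n lcm1n.
Qed.

HB.instance Definition _ :=
  Monoid.isComLaw.Build soc soc_one soc_mul soc_mulA soc_mulC soc_mul1.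

(* Main.v *)
Require Import Defs.
From mathcomp Require Import all_boot all_order all_algebra finmap multiset.
From mathcomp Require Import all_classical all_reals all_analysis.
From mathcomp Require Import lra zify.
Set Implicit Arguments.
Unset Strict Implicit.
Unset Printing Implicit Defensive.
Import Order.TTheory GRing.Theory Num.Theory.
Import numFieldNormedType.Exports.
Local Open Scope classical_set_scope.
Local Open Scope ring_scope.

(** The vertex count is multiplicative, and every irreducible sum of cycles
    other than [soc_one] has at least two vertices ([irreducible_nvert_ge2]).
    Listing the factors of an irreducible factorization by increasing vertex
    count is therefore an injection into [Ptimes n], whence [fact_le_ptimes].

    The bound on [ptimes n] has an additive and a multiplicative half. Write
    p(n) for the number [npart n] of sums of cycles with n vertices, that is,
    of partitions of n, and c for the constant pi sqrt(2/3).

    Additive half, [npart_le_hr_exp]: p(n) <= exp(c sqrt n), by an argument of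
    Erdos. Counting vertices by cycle length v and rank k among the cycles of
    that length gives n p(n) <= sum_(k v <= n) v p(n - k v)
    ([npart_recurrence]). Insert the bound for smaller arguments, replace the
    square root by its tangent at n, and sum over v ([weighted_exp_sum]); the
    sum over k of 1/k^2 that remains is at most pi^2/6, and c is exactly the
    constant for which the induction closes, because c^2 = 4 pi^2/6.

    Multiplicative half, [size_Ptimes_list]: by induction, [ptimes n] is at
    most (n - 1) exp(c sqrt n). A sequence in [Ptimes n] is either a single
    factor, or a first factor A followed by an element of [Ptimes (n / d)],
    where d = |A| is smallest and hence d^2 <= n. For such d and m = n / d, the
    product p(d) exp(c sqrt m) is at most 4 / 2^d times exp(c sqrt n), even with
    p(d) replaced by the crude bound 2^(d-1) ([smallest_factor_gain]), and these
    ratios are summable over d. *)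

(** * The sum of the inverse squares *)

Section Basel.
Variable R : realType.
Implicit Types (x : R) (F : nat -> R).

Lemma sin_le_id x : 0 <= x -> sin x <= x.
Proof.
rewrite le_eqVlt => /predU1P[<-|x0]; first by rewrite sin0.
have [|c _] := @MVT R sin cos 0 x x0 (fun y _ => is_derive_sin y).
  by apply: continuous_subspaceT => y; exact: continuous_sin.
by rewrite sin0 !subr0 => ->; rewrite ler_piMl ?cos_le1 // ltW.
Qed.

(** The identity that carries the evaluation of [sum_csc2]: a cosecant square is
    a quarter of the sum of those at the half angle and at its complement. *)
Lemma csc2_double x : sin x != 0 -> cos x != 0 ->
  (sin x ^+ 2)^-1 + (cos x ^+ 2)^-1 = 4 * (sin (x *+ 2) ^+ 2)^-1.
Proof.
move=> s0 c0.
have s20 : sin x ^+ 2 != 0 by rewrite expf_neq0.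
have c20 : cos x ^+ 2 != 0 by rewrite expf_neq0.
have -> : sin (x *+ 2) ^+ 2 = 4 * (sin x ^+ 2 * cos x ^+ 2).
  by rewrite sin_mulr2n; lra.
have s2c2 : sin x ^+ 2 = 1 - cos x ^+ 2 by rewrite sin2cos2.
rewrite [in RHS]invfM mulrA divff ?pnatr_eq0 // mul1r.
apply: (mulfI (mulf_neq0 s20 c20)); rewrite divff ?mulf_neq0 // mulrDr.
rewrite mulrAC divff // mul1r mulfK // s2c2; lra.
Qed.

Lemma sum_fold_half F (N : nat) : (0 < N)%N ->
  \sum_(1 <= k < N.*2) F k = \sum_(1 <= k < N) (F k + F (N.*2 - k)%N) + F N.
Proof.
move=> N0; rewrite big_split /= (big_cat_nat (n := N)) //=; last by lia.
rewrite -addrA; congr (_ + _); rewrite big_ltn; last by lia.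
rewrite addrC; congr (_ + _).
rewrite [RHS]big_nat_rev /= -[N.+1]add1n big_addn.
rewrite (_ : (N.*2 - N)%N = N); last by lia.
by apply: eq_big_nat => i /andP[i1 iN]; congr F; lia.
Qed.

(** Folding the interval of angles (0, pi/2) about pi/4 pairs each angle with
    its complement, so [csc2_double] turns this sum U_n into
    U_(n+1) = 4 U_n + 2; the 2 is the unpaired term at pi/4. *)
Lemma sum_csc2 (n : nat) :
  \sum_(1 <= k < 2 ^ n) (sin (k%:R * (pi / 2 ^+ n.+1)) ^+ 2)^-1 =
  2 * (4 ^+ n - 1) / 3 :> R.
Proof.
elim: n => [|n IHn]; first by rewrite big_geq // subrr mulr0 mul0r.
rewrite expnS mul2n sum_fold_half ?expn_gt0 //.
set t : R := pi / 2 ^+ n.+2.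
have t0 : 0 < t by rewrite divr_gt0 ?pi_gt0 ?exprn_gt0.
have t2 : pi / 2 ^+ n.+1 = t *+ 2.
  by rewrite /t [2 ^+ n.+2]exprS invfM; move: (2 ^+ n.+1)^-1 => u; lra.
have tE : (2 ^ n)%:R * t = pi / 4.
  rewrite /t natrX exprS invfM exprS invfM.
  have uv : 2 ^+ n * (2 ^+ n)^-1 = 1 :> R by rewrite divff ?expf_neq0.
  rewrite -[RHS]mul1r -[X in _ = X * _]uv.
  by move: (2 ^+ n : R) ((2 ^+ n)^-1) => u v; lra.
under eq_big_nat => k /andP[k1 kn].
  have k0 : 0 < k%:R * t by rewrite mulr_gt0 ?ltr0n.
  have kpi : k%:R * t < pi / 2.
    apply: lt_trans (_ : pi / 4 < _); first by rewrite -tE ltr_pM2r ?ltr_nat.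
    by have := pi_gt0 R; lra.
  rewrite (_ : ((2 ^ n).*2 - k)%:R * t = pi / 2 - k%:R * t); last first.
    rewrite natrB; last by lia.
    by rewrite -muln2 natrM mulrBl mulrAC tE; lra.
  rewrite -opprB sinN sinBpihalf opprK csc2_double; last first.
  - by rewrite gt_eqF // cos_gt0_pihalf // kpi andbT; lra.
  - by rewrite gt_eqF // sin_gt0_pihalf // k0.
  rewrite -mulrnAr -t2; over.
rewrite -mulr_sumr IHn tE (_ : pi / 4 = (pi / 2) / 2); last by lra.
have -> : sin (pi / 2 / 2) ^+ 2 = 1 / 2 :> R.
  have := cos_mulr2n (pi / 2 / 2 : R).
  rewrite (_ : pi / 2 / 2 *+ 2 = pi / 2); last by lra.
  by rewrite cos_pihalf cos2sin2 => e; lra.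
by rewrite exprS; lra.
Qed.

(** Half of the Basel problem: since sin x <= x, each 1/k^2 is at most a multiple
    of a term of [sum_csc2], and the closed form there stays below pi^2/6. *)
Lemma sum_inv_squares_le (N : nat) :
  \sum_(1 <= k < N.+1) (k%:R ^+ 2)^-1 <= pi ^+ 2 / 6 :> R.
Proof.
set t : R := pi / 2 ^+ N.+1.
have t0 : 0 < t by rewrite divr_gt0 ?pi_gt0 ?exprn_gt0.
have csc_ge k : (1 <= k < 2 ^ N)%N ->
    (k%:R ^+ 2)^-1 <= t ^+ 2 * (sin (k%:R * t) ^+ 2)^-1.
  move=> /andP[k1 kN].
  have k0 : 0 < k%:R * t by rewrite mulr_gt0 ?ltr0n.
  have kpi : k%:R * t < pi / 2.
    apply: lt_le_trans (_ : 2 ^+ N * t <= _).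
      by rewrite ltr_pM2r // -natrX ltr_nat.
    rewrite /t exprS invfM.
    have : 2 ^+ N * (2 ^+ N)^-1 = 1 :> R by rewrite divff ?expf_neq0.
    move=> uv; rewrite -[leRHS]mul1r -[X in _ <= X * _]uv.
    by move: (2 ^+ N : R) ((2 ^+ N)^-1) => u v; lra.
  have s0 : 0 < sin (k%:R * t) by rewrite sin_gt0_pihalf // k0.
  rewrite -[leLHS]invrK -[t ^+ 2]invrK -invfM lef_pV2 ?posrE; last first.
  - by rewrite mulr_gt0 ?invr_gt0 ?exprn_gt0.
  - by rewrite !invr_gt0 exprn_gt0 ?ltr0n.
  rewrite invrK ler_pdivrMl ?exprn_gt0 // -exprMn [t * _]mulrC.
  by rewrite ler_sqr ?nnegrE ?(ltW s0) ?(ltW k0) // sin_le_id ?ltW.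
apply: (@le_trans _ _ (\sum_(1 <= k < 2 ^ N) (k%:R ^+ 2)^-1)).
  rewrite [leRHS](@big_cat_nat _ _ _ N.+1) //=; last by rewrite ltn_expl.
  by rewrite lerDl sumr_ge0 // => k _; rewrite invr_ge0 exprn_ge0.
apply: le_trans (ler_sum_nat csc_ge) _.
rewrite -mulr_sumr sum_csc2 /t.
have -> : 4 ^+ N = (2 ^+ N) ^+ 2 :> R by rewrite exprAC; congr (_ ^+ _); lra.
have : 1 <= 2 ^+ N :> R by rewrite exprn_ege1 ?ler1n.
rewrite [2 ^+ N.+1]exprS; set u := 2 ^+ N => u1.
have u0 : u != 0 by rewrite gt_eqF //; lra.
have uv : u * u^-1 = 1 by rewrite divff.
rewrite (invfM _ u); set v := u^-1 in uv *.
have uv2 : (u * v) ^+ 2 = 1 by rewrite uv expr1n.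
have pv2 : 0 <= (pi * v) ^+ 2 by apply: sqr_ge0.
by nra.
Qed.

End Basel.

(** * Counting through injections *)

Local Open Scope nat_scope.

Lemma size_le_card_fset_set (T U : choiceType) (s : seq T) (f : T -> U)
    (B : set U) : finite_set B -> uniq s -> {in s &, injective f} ->
  (forall x, x \in s -> B (f x)) -> size s <= #|` fset_set B|.
Proof.
move=> finB us fI fB; rewrite -(size_map f); apply: uniq_leq_size.
  by rewrite map_inj_in_uniq.
by move=> _ /mapP[x xs ->]; rewrite in_fset_set // inE; apply: fB.
Qed.

Lemma card_fset_set_le_size (T U : choiceType) (A : set T) (f : T -> U)
    (l : seq U) : {in A &, injective f} -> (forall x, A x -> f x \in l) ->
  finite_set A /\ #|` fset_set A| <= size l.
Proof.
move=> fI fl; have finA : finite_set A.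
  rewrite -(eq_finite_set (inj_card_eq fI)).
  apply: (@sub_finite_set _ _ [set` l]); last exact: finite_seq.
  by move=> _ [x Ax <-]; apply: fl.
split=> //; rewrite -(size_map f); apply: uniq_leq_size.
  rewrite map_inj_in_uniq ?fset_uniq // => x y.
  by rewrite !in_fset_set //; apply: fI.
by move=> _ /mapP[x + ->]; rewrite in_fset_set // inE; apply: fl.
Qed.

(** * Sums of cycles with a given number of vertices *)

(** Every sum of cycles has its list of lengths here, which gives both finiteness
    and the crude bound 2^(n-1). In the second part, [head 0] never meets
    its default value: the empty list is filtered out. *)
Fixpoint compositions (n : nat) : seq (seq nat) :=
  if n is m.+1 then
    [seq 1 :: s | s <- compositions m] ++
    [seq (head 0 s).+1 :: behead s | s <- compositions m & s != [::]]
  else [:: [::]].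

Lemma size_compositions (n : nat) : size (compositions n) <= 2 ^ n.-1.
Proof.
elim: n => [|[|n] IHn] //; rewrite [compositions _]/= -/(compositions n.+1).
rewrite size_cat !size_map expnS mul2n -addnn leq_add //.
by rewrite size_filter (leq_trans (count_size _ _)).
Qed.

(** A composition of n + 1 either starts with 1, and then the tail is a
    composition of n, or else decreasing its first part gives one. *)
Lemma mem_compositions (n : nat) (s : seq nat) :
  0 \notin s -> sumn s = n -> s \in compositions n.
Proof.
elim: n s => [|n IHn] [|[|[|l]] s] //= s0 [sn].
  rewrite mem_cat map_f // IHn //.
rewrite mem_cat; apply/orP; right.
apply/mapP; exists (l.+1 :: s) => //; rewrite mem_filter /= IHn //.
Qed.

Definition soc_of_nvert (n : nat) : set soc := [set A | nvert A = n].

Definition npart (n : nat) : nat := #|` fset_set (soc_of_nvert n)|.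

Lemma enum_lengths_inj : injective (fun A : soc => enum_mset (lengths A)).
Proof.
move=> A B AB; apply: val_inj => /=.
by rewrite -[LHS]seq_mset_id AB seq_mset_id.
Qed.

Lemma lengths_compositions (A : soc) :
  enum_mset (lengths A) \in compositions (nvert A).
Proof. by rewrite mem_compositions ?sumnE // (valP A). Qed.

Lemma npart_bound (n : nat) :
  finite_set (soc_of_nvert n) /\ npart n <= 2 ^ n.-1.
Proof.
have [] := @card_fset_set_le_size _ _ (soc_of_nvert n) _ (compositions n)
  (fun A B _ _ => @enum_lengths_inj A B).
  by move=> A <-; apply: lengths_compositions.
by move=> finA pn; split=> //; apply: leq_trans (size_compositions n).
Qed.

Lemma finite_soc_of_nvert (n : nat) : finite_set (soc_of_nvert n).
Proof. exact: (npart_bound n).1. Qed.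

Lemma nvert_eq1 (A : soc) : nvert A = 1 -> A = soc_one.
Proof.
move=> A1; have := lengths_compositions A; rewrite A1 inE => /eqP AE.
by apply: enum_lengths_inj; rewrite AE /= enum_msetn.
Qed.

Lemma nvert_one : nvert soc_one = 1.
Proof. by rewrite /nvert /= enum_msetn big_seq1. Qed.

(** The empty sum of cycles is idempotent and so not irreducible. *)
Lemma nvert_eq0 (A : soc) : nvert A = 0 -> soc_mul A A = A.
Proof.
move=> A0; have := lengths_compositions A; rewrite A0 inE => /eqP AE.
by apply: val_inj; rewrite /= AE /lengths_mul /= -AE seq_mset_id.
Qed.

Lemma nvert_mul (A B : soc) : nvert (soc_mul A B) = nvert A * nvert B.
Proof.
rewrite -!card_digraph_of; have [f fB _] := digraph_of_mul A B.
by rewrite (bij_eq_card fB) card_prod.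
Qed.

Lemma nvert_prod (s : seq soc) : nvert (soc_prod s) = \prod_(A <- s) nvert A.
Proof. exact: (big_morph nvert nvert_mul nvert_one). Qed.

Lemma irreducible_nvert_ge2 (A : soc) :
  soc_irreducible A -> A <> soc_one -> 2 <= nvert A.
Proof.
move=> irrA A1; case nA: (nvert A) => [|[|n]] //.
  by case: (irrA A A) => //; rewrite nvert_eq0.
by case: A1; apply: nvert_eq1.
Qed.

Lemma soc_prod_perm (s t : seq soc) : perm_eq s t -> soc_prod s = soc_prod t.
Proof. exact: perm_big. Qed.

(** The injection sorts the factors by vertex count; sorting loses nothing
    because a multiset is determined by any enumeration of it. *)
Lemma fact_le_ptimes (n : nat) (X : soc) : finite_set (Ptimes n) ->
  nvert X = n -> finite_set (irr_factorizations X) /\ fact X <= ptimes n.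
Proof.
move=> finP nX.
pose f (F : {mset soc}%mset) : seq soc := sort (relpre nvert leq) F.
have fP F : irr_factorizations X F -> Ptimes n (f F).
  case=> irrF prodF; split; last split.
  - apply/allP => A; rewrite mem_sort => /irrF[irrA A1].
    exact: irreducible_nvert_ge2.
  - rewrite sorted_map; apply: sort_sorted => A B; exact: leq_total.
  - by rewrite (soc_prod_perm (permEl (perm_sort _ _))) prodF.
have fI : injective f.
  move=> F G FG; rewrite -(seq_mset_id F) -(seq_mset_id G).
  apply/eq_seq_msetP; rewrite -(perm_sort (relpre nvert leq)).
  by rewrite -/(f F) FG perm_sort.
apply: (card_fset_set_le_size (f := f)) => [|F /fP].
  by move=> F G _ _; apply: fI.
by rewrite in_fset_set // inE.
Qed.

(** * The recurrence for the number of partitions *)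

Lemma sum_seq_count (n : nat) (s : seq nat) :
  all (fun l => 0 < l <= n) s ->
  \sum_(l <- s) l = \sum_(1 <= v < n.+1) v * count_mem v s.
Proof.
move=> /allP sn.
rewrite (eq_big_seq (fun l => \sum_(1 <= v < n.+1 | v == l) v)); last first.
  by move=> l /sn ln; rewrite big_nat1_eq ltnS ln.
under eq_bigr do rewrite big_mkcond.
rewrite exchange_big; apply: eq_bigr => v _ /=.
rewrite -big_mkcond /= -sum1_count big_distrr /=.
by apply: eq_big => // l; rewrite ?muln1 // eq_sym.
Qed.

Lemma nvert_multiplicity (A : soc) (n : nat) : nvert A <= n ->
  nvert A = \sum_(1 <= v < n.+1) v * lengths A v.
Proof.
move=> An; rewrite /nvert (@sum_seq_count n); last first.
  apply/allP => l lA; rewrite lt0n.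
  rewrite (contraTneq _ lA) => [|->]; last exact: (valP A).
  apply: leq_trans An; rewrite /nvert (perm_big _ (perm_to_rem lA)) big_cons.
  exact: leq_addr.
by under eq_bigr do rewrite count_mem_mset.
Qed.

Fact remove_cycles_subproof (A : soc) (v k : nat) :
  0 \notin msetB (lengths A) (msetn k v).
Proof.
by rewrite in_msetB -leqNgt (eqP (_ : lengths A 0 == 0)) // mset_eq0 (valP A).
Qed.

(** The subtraction of multisets is truncated, so this deletes all the cycles of
    length v when there are fewer than k of them. *)
Definition remove_cycles (A : soc) (v k : nat) : soc :=
  Soc (remove_cycles_subproof A v k).

Lemma remove_cyclesK (A : soc) (v k : nat) : k <= lengths A v ->
  msetD (lengths (remove_cycles A v k)) (msetn k v) = lengths A.
Proof.
move=> kA; apply: msetBDK; apply/msubsetP => u; rewrite msetnE.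
by case: eqP => // ->.
Qed.

Lemma nvert_remove_cycles (A : soc) (v k : nat) : k <= lengths A v ->
  nvert (remove_cycles A v k) + k * v = nvert A.
Proof.
move=> kA; rewrite /nvert -(remove_cyclesK kA).
set B := lengths _; rewrite [RHS](@perm_big _ _ _ _ _ (B ++ msetn k v)).
  by rewrite big_cat /= enum_msetn big_nseq iter_addn addn0 mulnC.
by apply/allP => u _ /=; rewrite count_cat !count_mem_mset msetE2.
Qed.

Lemma sum_ltn_indicator (m n : nat) : m <= n ->
  \sum_(1 <= k < n.+1) (k <= m) = m.
Proof.
move=> mn; rewrite (big_cat_nat (n := m.+1)) //= big_nat.
rewrite (eq_bigr (fun=> 1)) => [|i /andP[_]]; last by rewrite ltnS => ->.
rewrite -big_nat sum_nat_const_nat subn1 muln1 big_nat big1 ?addn0 // => i.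
by case/andP=> mi _; rewrite leqNgt mi.
Qed.

(** Deleting k cycles of length v is injective on the sums of cycles that have
    that many, and leaves n - k v vertices. *)
Lemma card_soc_many_cycles (n v k : nat) :
  \sum_(A <- fset_set (soc_of_nvert n)) (k <= lengths A v) <=
  if k * v <= n then npart (n - k * v) else 0.
Proof.
set V := fset_set _; have VE A : A \in V -> nvert A = n.
  by rewrite in_fset_set ?inE //; apply: finite_soc_of_nvert.
rewrite -big_mkcond /= sum1_count -size_filter.
case: ifPn => [kvn|nkv].
  apply: (@size_le_card_fset_set _ _ _ (fun A => remove_cycles A v k)).
  - exact: finite_soc_of_nvert.
  - by rewrite filter_uniq // fset_uniq.
  - move=> A B; rewrite !mem_filter => /andP[kA _] /andP[kB _] AB.
    by apply: val_inj; rewrite /= -(remove_cyclesK kA) AB remove_cyclesK.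
  - move=> A; rewrite mem_filter => /andP[kA /VE <-].
    by rewrite /soc_of_nvert /= -(nvert_remove_cycles kA) addnK.
rewrite leqn0 size_eq0; rewrite -[_ == _]negbK -has_filter.
apply/hasP => -[A /VE nA kA]; case/negP: nkv.
by rewrite -nA -(nvert_remove_cycles kA) leq_addl.
Qed.

(** Both sides count vertices over all sums of cycles with n vertices: the
    multiplicity of v is the number of k >= 1 that it dominates, and for given
    k and v those with at least k cycles of length v are counted by
    [card_soc_many_cycles]. *)
Lemma npart_recurrence (n : nat) :
  n * npart n <=
  \sum_(1 <= k < n.+1) \sum_(1 <= v < n.+1 | k * v <= n) v * npart (n - k * v).
Proof.
set V := fset_set (soc_of_nvert n).
have VE A : A \in V -> nvert A = n.
  by rewrite in_fset_set ?inE //; apply: finite_soc_of_nvert.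
have -> : n * npart n = \sum_(A <- V) nvert A.
  rewrite (eq_big_seq (fun=> n)) //.
  by rewrite big_const_seq count_predT iter_addn addn0.
rewrite (eq_big_seq (fun A => \sum_(1 <= k < n.+1)
   \sum_(1 <= v < n.+1) v * (k <= lengths A v))); last first.
  move=> A /VE nA; rewrite (@nvert_multiplicity A n) ?nA // exchange_big_nat /=.
  apply: eq_big_nat => v /andP[v1 vn]; rewrite -big_distrr /=.
  rewrite sum_ltn_indicator // -nA.
  rewrite -(nvert_remove_cycles (leqnn (lengths A v))).
  by rewrite (leq_trans (leq_pmulr _ v1)) ?leq_addl.
rewrite exchange_big; apply: leq_sum => k _ /=.
rewrite exchange_big [leqRHS]big_mkcond /=; apply: leq_sum => v _.
rewrite -big_distrr /=.
rewrite (leq_trans (leq_mul (leqnn v) (card_soc_many_cycles n v k))) //.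
by case: ifP => //; rewrite muln0.
Qed.

(** * The exponential bound on the number of partitions *)

Local Open Scope ring_scope.

Section PartitionBound.
Variable R : realType.
Implicit Types (x y z q : R).

(** The Hardy-Ramanujan constant in the growth of the partition function. *)
Definition hr_const : R := pi * Num.sqrt (2 / 3).
Notation c := hr_const.
Definition hr_exp (n : nat) : R := expR (c * Num.sqrt n%:R).

Lemma hr_const_sqr : c ^+ 2 = 4 * (pi ^+ 2 / 6).
Proof. by rewrite /hr_const exprMn sqr_sqrtr; lra. Qed.

(** Equivalently pi^2/6 >= 1, which is the first term of the Basel sum. *)
Lemma hr_const_ge2 : 2 <= c.
Proof.
have c0 : 0 <= c by rewrite mulr_ge0 ?pi_ge0 ?sqrtr_ge0.
have := sum_inv_squares_le R 1; rewrite big_nat1 expr1n invr1 => h.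
by have := hr_const_sqr; nra.
Qed.

Lemma sinh_ge z : 0 <= z -> 2 * z <= expR z - expR (- z).
Proof.
rewrite le_eqVlt => /predU1P[<-|z0]; first by rewrite mulr0 oppr0 subrr.
pose f x : R := expR x - expR (- x).
have fd x : is_derive x 1 f (expR x + expR (- x)).
  rewrite /f; apply: is_derive_eq; rewrite /GRing.scale /=; lra.
have [|w _] := @MVT R f _ 0 z z0 (fun x _ => fd x).
  apply: derivable_within_continuous => x _; exact: ex_derive.
rewrite /f oppr0 addr0 subrr !subr0 => ->; rewrite ler_pM2r // expRN.
have w0 := expR_gt0 w; rewrite -(ler_pM2r w0) [leRHS]mulrDl mulVf ?gt_eqF //.
by have := sqr_ge0 (expR w - 1); lra.
Qed.

Lemma weighted_geometric_sum (n : nat) q : (1 - q) ^+ 2 *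
  \sum_(1 <= v < n.+1) v%:R * q ^+ v = q - q ^+ n.+1 * (n.+1%:R - n%:R * q).
Proof.
elim: n => [|n IHn]; first by rewrite big_geq // expr1; lra.
rewrite big_nat_recr //= mulrDr IHn ![q ^+ _.+1]exprS -!natr1.
by move: (n%:R : R) (q ^+ n) => u v; lra.
Qed.

(** With q = exp(-y) the full series sums to q / (1 - q)^2, which equals
    1 / (2 sinh(y/2))^2, and sinh is at least the identity. *)
Lemma weighted_exp_sum (n : nat) y : 0 < y ->
  \sum_(1 <= v < n.+1) v%:R * expR (- (y * v%:R)) <= (y ^+ 2)^-1.
Proof.
move=> y0; pose q := expR (- y).
have q0 : 0 < q by apply: expR_gt0.
have q1 : q < 1 by rewrite expR_lt1 oppr_lt0.
under eq_bigr do rewrite -mulNr expRM_natr -/q.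
rewrite -[leRHS]mul1r ler_pdivlMr ?exprn_gt0 //.
have /(congr1 (fun x => x * y ^+ 2)) e := weighted_geometric_sum n q.
have qy : q * y ^+ 2 <= (1 - q) ^+ 2.
  (* Dividing by q = r ^+ 2, this is the square of y <= 2 sinh (y / 2). *)
  have := sinh_ge (ltW (divr_gt0 y0 (ltr0n R 2))).
  set r := expR (- (y / 2)).
  have r0 : 0 < r by apply: expR_gt0.
  have qr : q = r ^+ 2 by rewrite /q /r -expRM_natl; congr expR; lra.
  rewrite -[y / 2]opprK expRN -/r opprK => h.
  have {}h : r * y <= 1 - q.
    move: h; rewrite -(ler_pM2r r0) mulrBl mulVf ?gt_eqF // qr; lra.
  rewrite [X in X * _]qr -exprMn ler_sqr // nnegrE.
    by rewrite mulr_ge0 // ltW.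
  by rewrite subr_ge0 ltW.
have q2 : 0 < (1 - q) ^+ 2 by rewrite exprn_gt0 // subr_gt0.
rewrite -(ler_pM2l q2) mulr1 mulrA e; apply: le_trans qy.
rewrite ler_wpM2r ?sqr_ge0 // lerBlDr lerDl mulr_ge0 ?exprn_ge0 ?ltW //.
by rewrite -natr1; have : 0 <= n%:R :> R by []; nra.
Qed.

Lemma sqrt_tangent x y : 0 < x -> 0 <= y <= x ->
  Num.sqrt (x - y) <= Num.sqrt x - y / (2 * Num.sqrt x).
Proof.
move=> x0 /andP[y0 yx]; have s0 : 0 < Num.sqrt x by rewrite sqrtr_gt0.
have sx : Num.sqrt x ^+ 2 = x by rewrite sqr_sqrtr ?ltW.
move: s0 sx; set s := Num.sqrt x => s0 sx.
set t := y / (2 * s).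
have ty : t * (2 * s) = y by rewrite divfK // gt_eqF // mulr_gt0.
have t0 : 0 <= t by rewrite divr_ge0 // mulr_ge0 // ltW.
have ts : t <= s by rewrite ler_pdivrMr ?mulr_gt0 //; nra.
rewrite -[leRHS]ger0_norm ?subr_ge0 // -sqrtr_sqr ler_wsqrtr //.
by have := sqr_ge0 t; nra.
Qed.

(** By strong induction on [npart_recurrence]: with s = sqrt n, the tangent
    bound turns the term of index (k, v) into
    v exp(c s) exp(- (c k / (2 s)) v), and the sum over v is at most
    exp(c s) 4 n / (c^2 k^2). *)
Lemma npart_le_hr_exp (n : nat) : (npart n)%:R <= hr_exp n.
Proof.
elim/ltn_ind: n => n IHn; have [->|n0] := posnP n.
  by rewrite /hr_exp sqrtr0 mulr0 expR0 (ler_nat R _ 1) (npart_bound 0).2.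
have c0 : 0 < c by apply: lt_le_trans hr_const_ge2.
have nR0 : 0 < n%:R :> R by rewrite ltr0n.
set s := Num.sqrt (n%:R : R).
have s0 : 0 < s by rewrite sqrtr_gt0.
have sn : s ^+ 2 = n%:R by rewrite sqr_sqrtr ?ltW.
have E0 := expR_gt0 (c * s); rewrite /hr_exp -/s in IHn *.
pose y (k : nat) : R := c * k%:R / (2 * s).
have y_gt0 k : (0 < k)%N -> 0 < y k.
  by move=> k0; rewrite divr_gt0 // mulr_gt0 // ltr0n.
have term k v : (1 <= k)%N -> (1 <= v)%N -> (k * v <= n)%N ->
    (npart (n - k * v))%:R <= expR (c * s) * expR (- (y k * v%:R)).
  move=> k1 v1 kvn; apply: le_trans (IHn _ _) _; first by nia.
  rewrite -expRD ler_expR natrB //.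
  have := @sqrt_tangent n%:R (k * v)%:R nR0.
  rewrite ler0n ler_nat kvn => /(_ isT) h.
  apply: le_trans (ler_wpM2l _ h) _; first exact: ltW.
  by rewrite mulrBr lerD2l lerN2 -/s /y natrM; move: (2 * s)^-1 => u; lra.
rewrite -(ler_pM2l nR0) -natrM.
apply: (@le_trans _ _ (\sum_(1 <= k < n.+1) \sum_(1 <= v < n.+1)
    v%:R * (expR (c * s) * expR (- (y k * v%:R))))).
  apply: (@le_trans _ _ (\sum_(1 <= k < n.+1)
      \sum_(1 <= v < n.+1 | (k * v <= n)%N) v * npart (n - k * v))%:R).
    by rewrite ler_nat npart_recurrence.
  rewrite natr_sum; apply: ler_sum_nat => k /andP[k1 _].
  rewrite natr_sum big_mkcond /=; apply: ler_sum_nat => v /andP[v1 _].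
  case: ifP => kvn; first by rewrite natrM ler_wpM2l // term.
  by rewrite !mulr_ge0 ?expR_ge0.
apply: (@le_trans _ _ (\sum_(1 <= k < n.+1)
    expR (c * s) * (4 * n%:R / c ^+ 2 * (k%:R ^+ 2)^-1))).
  apply: ler_sum_nat => k /andP[k1 _].
  under eq_bigr do rewrite mulrCA.
  rewrite -mulr_sumr ler_pM2l //.
  apply: le_trans (weighted_exp_sum n (y_gt0 _ k1)) _.
  rewrite /y expr_div_n invf_div [(2 * s) ^+ 2]exprMn [(c * _) ^+ 2]exprMn sn.
  by rewrite invfM mulrA (_ : 2 ^+ 2 = 4) //; lra.
rewrite -!mulr_sumr mulrC ler_pM2r //.
rewrite hr_const_sqr.
have p0 : 0 < pi ^+ 2 / 6 :> R by rewrite divr_gt0 ?exprn_gt0 ?pi_gt0.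
have := sum_inv_squares_le R n; move: (pi ^+ 2 / 6) p0 => p p0 Sp.
apply: le_trans (ler_wpM2l _ Sp) _; first by rewrite ltW ?divr_gt0 ?mulr_gt0.
by rewrite -mulf_div divff // mul1r divfK ?gt_eqF.
Qed.

End PartitionBound.

(** * Factorizations into an ordered sequence *)

(** A list containing [Ptimes n] when 2 <= n and the fuel is at least n; it
    contains also unsorted sequences, since only the first factor is compared, through
    d * d <= n, with the product of the others. *)
Fixpoint Ptimes_list (fuel n : nat) : seq (seq soc) :=
  if fuel is f.+1 then
    [seq [:: A] | A <- fset_set (soc_of_nvert n)] ++
    flatten [seq [seq A :: s | A <- fset_set (soc_of_nvert d),
                               s <- Ptimes_list f (n %/ d)%N]
            | d <- index_iota 2 n.+1 & (d %| n)%N && (d * d <= n)%N]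
  else [::].

(** When a second factor is present it has at least as many vertices as the
    first, so the cofactor of d = |A| has at least d vertices. *)
Lemma mem_Ptimes_list (fuel n : nat) (s : seq soc) : (2 <= n <= fuel)%N ->
  Ptimes n s -> s \in Ptimes_list fuel n.
Proof.
elim: fuel n s => [|f IHf] n [|A s] /andP[n2 nf]; try by move: n2 nf; lia.
  by case=> _ [_]; rewrite nvert_prod big_nil => n1; rewrite -n1 in n2.
case; rewrite /= => /andP[A2 s2] [srt].
rewrite nvert_prod big_cons -nvert_prod => prodE.
case: s => [|B s] in s2 srt prodE *.
  rewrite nvert_prod big_nil muln1 in prodE.
  rewrite mem_cat map_f // in_fset_set ?inE //.
  exact: finite_soc_of_nvert.
set m := nvert (soc_prod _) in prodE.
have Bm : (nvert B <= m)%N.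
  rewrite /m nvert_prod big_cons leq_pmulr // big_seq prodn_cond_gt0 // => C Cs.
  by move/allP: s2 => /(_ C); rewrite inE Cs orbT => /(_ isT); lia.
have AB : (nvert A <= nvert B)%N by case/andP: srt.
have B2 : (2 <= nvert B)%N by case/andP: s2.
rewrite mem_cat; apply/orP; right; apply/flattenP.
exists [seq C :: t | C <- fset_set (soc_of_nvert (nvert A)),
                     t <- Ptimes_list f (n %/ nvert A)%N].
  apply/mapP; exists (nvert A) => //.
  rewrite mem_filter mem_index_iota -prodE dvdn_mulr //.
  by rewrite leq_mul2l (leq_trans AB Bm) orbT A2 ltnS leq_pmulr //; lia.
apply/allpairsP; exists (A, B :: s); split=> //=.
  by rewrite in_fset_set ?inE //; apply: finite_soc_of_nvert.
rewrite -prodE mulKn; last by lia.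
apply: IHf; first by apply/andP; split; nia.
by split=> //; split=> //; case/andP: srt.
Qed.

Section FactorizationBound.
Variable R : realType.

(** Raising the bound 1 + 1/8 <= exp(1/8) to the power 12 already suffices. *)
Lemma expR_3half_ge4 : 4 <= expR (3 / 2) :> R.
Proof.
rewrite (_ : 3 / 2 = 12%:R * 8^-1); last by lra.
rewrite expRM_natl; apply: (@le_trans _ _ ((1 + 8^-1) ^+ 12)); first by lra.
by rewrite lerXn2r ?nnegrE ?expR_ge0 ?expR_ge1Dx //; lra.
Qed.

(** Since d <= m, the exponent grows by
    c (sqrt (d m) - sqrt m) >= 2 (d - sqrt d) >= 3 d / 2 - 2, and
    exp(3/2) >= 4 turns this into the factor 4^d that pays for both powers
    of 2; the offset is absorbed by writing d = j + 2. *)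
Lemma smallest_factor_gain (d m : nat) : (2 <= d <= m)%N ->
  (2 ^ d.-1)%:R * hr_exp R m <= 4 * 2^-1 ^+ d * hr_exp R (d * m).
Proof.
case: d => [|[|j]] // /andP[_ dm].
set sd := Num.sqrt (j.+2%:R : R); set sm := Num.sqrt (m%:R : R).
have sd2 : sd ^+ 2 = j.+2%:R by rewrite sqr_sqrtr.
have sdm : sd <= sm by rewrite ler_wsqrtr // ler_nat.
have sd1 : 1 <= sd by rewrite -sqrtr1 ler_wsqrtr // ler1n.
have c2 := hr_const_ge2 R.
rewrite /hr_exp natrM sqrtrM // -/sd -/sm.
have gap : 1 + 3 / 2 * j%:R <= hr_const R * (sd * sm) - hr_const R * sm.
  rewrite -[j.+2]addn2 natrD in sd2.
  have : 1 + 3 / 2 * j%:R <= 2 * (sd * (sd - 1)).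
    (* This is 2 sqrt d <= d / 2 + 2. *)
    by have := sqr_ge0 (sd - 2); lra.
  move=> h; apply: le_trans h _.
  have : sd * (sd - 1) <= sm * (sd - 1) by rewrite ler_wpM2r // subr_ge0.
  have : 0 <= sm * (sd - 1) by rewrite mulr_ge0 ?subr_ge0 ?sqrtr_ge0.
  by nra.
have e2 : 2 * 4 ^+ j <= expR (hr_const R * (sd * sm)) / expR (hr_const R * sm).
  rewrite -expRB; apply: (@le_trans _ _ (expR (1 + 3 / 2 * j%:R))); last first.
    by rewrite ler_expR.
  rewrite expRD expRM_natr ler_pM ?exprn_ge0 //.
    by apply: le_trans (expR_ge1Dx _); lra.
  by rewrite lerXn2r ?nnegrE ?expR_ge0 // expR_3half_ge4.
rewrite ler_pdivlMr ?expR_gt0 // in e2.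
have uw : 2 ^+ j * 2^-1 ^+ j = 1 :> R by rewrite -exprMn divff // expr1n.
have u2 : 4 ^+ j = 2 ^+ j * 2 ^+ j :> R by rewrite -exprMn; congr (_ ^+ _); lra.
have w0 : 0 <= 2^-1 ^+ j :> R by rewrite exprn_ge0.
rewrite /= natrX exprS [2^-1 ^+ j.+2]exprS [2^-1 ^+ j.+1]exprS.
rewrite [leRHS](_ : _ = 2^-1 ^+ j * expR (hr_const R * (sd * sm))); last by lra.
apply: le_trans (ler_wpM2l w0 e2); rewrite u2.
have -> : 2^-1 ^+ j * (2 * (2 ^+ j * 2 ^+ j) * expR (hr_const R * sm)) =
  (2 ^+ j * 2^-1 ^+ j) * (2 * 2 ^+ j * expR (hr_const R * sm)) by lra.
by rewrite uw mul1r.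
Qed.

Lemma sum_half_powers (n : nat) :
  \sum_(2 <= d < n.+1) 2^-1 ^+ d <= 2^-1 :> R.
Proof.
case: n => [|n]; first by rewrite big_geq.
suff -> : \sum_(2 <= d < n.+2) 2^-1 ^+ d = 2^-1 - 2^-1 ^+ n.+1 :> R.
  by rewrite lerBlDr lerDl exprn_ge0.
elim: n => [|n IHn]; first by rewrite big_geq // subrr.
by rewrite big_nat_recr //= IHn [2^-1 ^+ n.+2]exprS; lra.
Qed.

(** Having n - 1 rather than n as the factor closes the induction without
    treating small n apart: the single factors use up 1, and the factorizations
    d m contribute at most 2 (n - 2) sum_(d >= 2) 2^-d <= n - 2, because
    m - 1 <= (n - 2) / 2. *)
Lemma size_Ptimes_list (fuel n : nat) : (2 <= n)%N ->
  (size (Ptimes_list fuel n))%:R <= (n.-1)%:R * hr_exp R n.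
Proof.
elim: fuel n => [|f IHf] n n2; first by rewrite mulr_ge0 ?expR_ge0.
rewrite /= size_cat size_map size_flatten /shape -map_comp sumnE.
rewrite big_map big_filter.
rewrite natrD natr_sum -/(npart n).
have nE : n.-1%:R = 1 + (n - 2)%:R :> R by rewrite -(natrD R 1); congr _%:R; lia.
rewrite nE mulrDl mul1r lerD ?npart_le_hr_exp //.
apply: (@le_trans _ _ (\sum_(2 <= d < n.+1)
    2 * (n - 2)%:R * hr_exp R n * 2^-1 ^+ d)); last first.
  rewrite -mulr_sumr; apply: le_trans (ler_wpM2l _ (sum_half_powers n)) _.
    by rewrite !mulr_ge0 ?expR_ge0.
  by lra.
rewrite big_mkcond; apply: ler_sum_nat => d /andP[d2 _].
case: ifP => [/andP[/dvdnP[m nm] ddn]|_]; last first.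
  by rewrite !mulr_ge0 ?expR_ge0 ?exprn_ge0.
rewrite mulnC in nm; rewrite /= size_allpairs -/(npart d).
have d0 : (0 < d)%N by lia.
have dm : (d <= m)%N by rewrite nm leq_pmul2l // in ddn.
have m2 : (2 <= m)%N by lia.
rewrite [in X in X <= _]nm mulKn // natrM.
apply: (@le_trans _ _ ((2 ^ d.-1)%:R * (m.-1%:R * hr_exp R m))).
  by rewrite ler_pM ?IHf // ler_nat (npart_bound d).2.
rewrite mulrCA.
have gain : (2 ^ d.-1)%:R * hr_exp R m <= 4 * 2^-1 ^+ d * hr_exp R n.
  by rewrite nm smallest_factor_gain // d2.
apply: le_trans (ler_wpM2l _ gain) _ => //.
have mn : 2 * m.-1%:R <= (n - 2)%:R :> R by rewrite -natrM ler_nat; nia.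
have p0 : 0 <= 2^-1 ^+ d * hr_exp R n by rewrite mulr_ge0 ?exprn_ge0 ?expR_ge0.
have := ler_wpM2r p0 mn; lra.
Qed.

Lemma ptimes_le_hr_exp (n : nat) : (2 <= n)%N ->
  finite_set (Ptimes n) /\ (ptimes n)%:R <= n%:R * hr_exp R n.
Proof.
move=> n2.
have [||finP ple] := @card_fset_set_le_size _ _ (Ptimes n) id (Ptimes_list n n).
- by [].
- by move=> s; apply: mem_Ptimes_list; rewrite n2 /=.
split=> //; apply: (@le_trans _ _ (n.-1%:R * hr_exp R n)).
  by apply: le_trans (size_Ptimes_list n n2); rewrite ler_nat.
by rewrite ler_wpM2r ?expR_ge0 // ler_nat leq_pred.
Qed.

(** This absorbs the polynomial factor n in the bound exp(O(sqrt n)). *)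
Lemma natr_le_expR_sqrt (n : nat) : n%:R <= expR (2 * Num.sqrt n%:R) :> R.
Proof.
rewrite expRM_natl -[leLHS]sqr_sqrtr // ler_sqr ?nnegrE ?sqrtr_ge0 ?expR_ge0 //.
by apply: le_trans (expR_ge1Dx _); lra.
Qed.

End FactorizationBound.

Theorem mainTheorem8 (R : realType) :
  (forall (n : nat) (X : soc), (2 <= n)%N -> nvert X = n ->
     [/\ finite_set (irr_factorizations X),
         finite_set (Ptimes n),
         (fact X <= ptimes n)%N &
         (ptimes n)%:R <=
           n%:R * expR (pi * Num.sqrt (2 / 3) * Num.sqrt n%:R) :> R])
  /\
  (exists2 f : nat -> R,
     f =O_\oo (fun n : nat => Num.sqrt n%:R : R) &
     forall (n : nat) (X : soc), (2 <= n)%N -> nvert X = n ->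
       (fact X)%:R <= expR (f n)).
Proof.
split=> [n X n2 nX|].
  have [finP ple] := ptimes_le_hr_exp R n2.
  by have [finF fle] := fact_le_ptimes finP nX; split.
exists (fun n => (2 + hr_const R) * Num.sqrt n%:R).
  apply/eqO_exP; exists (2 + hr_const R).
    by have := hr_const_ge2 R; lra.
  apply: filterE => n.
  rewrite normrM ler_wpM2r // ger0_norm //.
  by have := hr_const_ge2 R; lra.
move=> n X n2 nX; have [finP ple] := ptimes_le_hr_exp R n2.
have [_ fle] := fact_le_ptimes finP nX.
apply: (@le_trans _ _ (ptimes n)%:R); first by rewrite ler_nat.
apply: le_trans ple _; rewrite mulrDl expRD ler_wpM2r ?expR_ge0 //.
exact: natr_le_expR_sqrt.
Qed.
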